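(* Let $n\ge3$ and let $\mathcal T$ be a set of tile designs for the $n$-bipyramid with symmetry group the prismatic group $D_{nh}$ (order $4n$). Suppose there are $t_{\mathrm{id}}$ isosceles triangular designs, $t_f$ of which are fixed under the reflection of the face. Then the number of ways of tiling the faces of the $n$-bipyramid up to $D_{nh}$ symmetry is as follows, where $\phi$ is Euler's totient function and $d$ runs over the positive divisors of $n$. When $n$ is even, $$\frac{1}{4n}\left(n\,t_{\mathrm{id}}^{n}+n\left(\tfrac12t_{\mathrm{id}}^{n}+\tfrac12t_{\mathrm{id}}^{n-2}t_f^{4}\right)+\sum_{d\mid n}\left(\phi(d)\,t_{\mathrm{id}}^{2n/d}+\phi(d)\,t_{\mathrm{id}}^{2n/\operatorname{lcm}(d,2)}\right)\right),$$ and when $n$ is odd, $$\frac{1}{4n}\left(n\,t_{\mathrm{id}}^{n}+n\,t_{\mathrm{id}}^{n-1}t_f^{2}+\sum_{d\mid n}\left(\phi(d)\,t_{\mathrm{id}}^{2n/d}+\phi(d)\,t_{\mathrm{id}}^{2n/\operatorname{lcm}(d,2)}\right)\right).$$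
   Context: Tilings. Let $P$ be a polyhedron with set of faces $\mathcal F$ and let $\mathcal A$ be a group of isometries of $P$, acting on $\mathcal F$. A set of tile designs is a finite set $\mathcal T$ together with a group action of $\mathcal A$ on $\mathcal T\times\mathcal F$ lying over the action on $\mathcal F$ (so $A\cdot(T,F)=(T',A\cdot F)$ for some $T'\in\mathcal T$). A tiling is a map $\tau:\mathcal F\to\mathcal T$; $\mathcal A$ acts on tilings by moving graphs: $A\cdot\tau$ is the tiling with $((A\cdot\tau)(A\cdot F),A\cdot F)=A\cdot(\tau(F),F)$ for all $F$. The number of ways of tiling up to $\mathcal A$ is the number of $\mathcal A$-orbits on the set of tilings. The induced symmetry group $G$ of a face $F$ is the group of isometries of $F$ realized by elements of the stabilizer $\mathcal A_F$; for $g\in G$, $t_g$ is the number of $T\in\mathcal T$ with $g\cdot(T,F)=(T,F)$, where $g$ acts via the element of $\mathcal A_F$ inducing it. Since $\mathcal A$ acts transitively on faces, $t_g$ does not depend on the choice of $F$. In particular $t_{\mathrm{id}}=|\mathcal T|$. Polyhedron and group. The $n$-bipyramid is the convex hull of the poles $(0,0,\pm z)$ (for a fixed $z>0$) and the equatorial points $(\cos(2k\pi/n),\sin(2k\pi/n),0)$, $0\le k<n$; it has $2n$ isosceles triangular faces and is dual to the $n$-prism. Here $\mathcal A=D_{nh}$ is the group of order $4n$ generated by the rotation by $2\pi/n$ about the $z$-axis, the reflection $(x,y,z)\mapsto(x,y,-z)$, and the reflection $(x,y,z)\mapsto(x,-y,z)$. The symmetry group it induces on a face is $\langle f\mid f^2=e\rangle$,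 with $f$ the reflection of the isosceles triangle fixing the pole and swapping the two equatorial vertices. *)

(* Defs.v *)
From HB Require Import structures.
From mathcomp Require Import all_boot all_order all_algebra.
From mathcomp Require Import all_classical all_reals all_analysis.

Set Implicit Arguments.
Unset Strict Implicit.
Unset Printing Implicit Defensive.

Import Order.TTheory GRing.Theory Num.Theory.

Local Open Scope classical_set_scope.
Local Open Scope ring_scope.

(** Points are column vectors, so that matrices act on them from the left. *)
Definition point3 (R : realType) := 'cV[R]_3.

Definition pt (R : realType) (x y z : R) : point3 R :=
  \col_(i < 3) [:: x; y; z]`_i.

Definition mx3 (R : realType) (rows : seq (seq R)) : 'M[R]_3 :=
  \matrix_(i < 3, j < 3) (nth [::] rows i)`_j.

Definition mximage (R : realType) (M : 'M[R]_3) (X : set (point3 R)) :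
    set (point3 R) :=
  (fun x : point3 R => M *m x) @` X.

Definition convex_hull (R : realType) (S : set (point3 R)) : set (point3 R) :=
  smallest (fun X : set (point3 R) =>
    convex_set (X : set (convex_lmodType (point3 R)))) S.

(** A face of [P] is the intersection of [P] with a supporting plane, of
    dimension 2, i.e. containing three affinely independent points. *)
Definition is_face (R : realType) (P F : set (point3 R)) : Prop :=
  (exists (a : 'rV[R]_3) (b : R),
     [/\ a != 0,
         (forall x, P x -> (a *m x) 0 0 <= b)
       & F = P `&` [set x | (a *m x) 0 0 = b]])
  /\ (exists x y w : point3 R,
        [/\ F x, F y, F w & \rank (row_mx (y - x) (w - x)) = 2%N]).

Definition faces (R : realType) (P : set (point3 R)) : set (set (point3 R)) :=
  [set F | is_face P F].

(** Linear isometries suffice, the polyhedron below being centred at [0];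
    orthogonality is with respect to the Euclidean inner product (the
    library's norm on matrices is the sup norm). *)
Definition isometry_group (R : realType) (A : set 'M[R]_3) : Prop :=
  [/\ (forall M, A M -> M^T *m M = 1%:M),
      A 1%:M,
      (forall M N, A M -> A N -> A (M *m N))
    & (forall M, A M -> A (invmx M))].

Definition generated_isometries (R : realType) (S : set 'M[R]_3) : set 'M[R]_3 :=
  smallest (@isometry_group R) S.

Section TileDesigns.
Variables (R : realType) (P : set (point3 R)) (A : set 'M[R]_3) (T : finType).

(** A group action of [A] on [T * faces P] lying over the action on faces. *)
Record tile_designs := TileDesigns {
  td_act :> A -> T * faces P -> T * faces P;
  td_act1 : forall g : A, \val g = 1%:M -> forall x, td_act g x = x;
  td_actM : forall g h k : A, \val k = \val g *m \val h ->
    forall x, td_act k x = td_act g (td_act h x);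
  td_over : forall (g : A) (t : T) (F : faces P),
    \val (td_act g (t, F)).2 = mximage (\val g) (\val F) }.

Definition tiling := faces P -> T.

Definition tiling_graph (tau : tiling) : set (T * faces P) :=
  range (fun F => (tau F, F)).

Variable D : tile_designs.

Definition moves_to (g : A) (tau sigma : tiling) : Prop :=
  tiling_graph sigma = D g @` tiling_graph tau.

Definition tiling_orbit (tau : tiling) : set tiling :=
  [set sigma | exists g : A, moves_to g tau sigma].

Definition tiling_orbits : set (set tiling) := range tiling_orbit.

(** [t_g], for the isometry of the face [F] induced by the element [g] of the
    stabilizer of [F]. *)
Definition fixed_designs (F : faces P) (g : A) : nat :=
  #|[pred t : T | `[< D g (t, F) = (t, F) >]]|.

End TileDesigns.

Section Bipyramid.
Variables (R : realType) (n : nat) (z : R).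

Definition pole (s : bool) : point3 R := pt 0 0 ((-1) ^+ s * z).

Definition equatorial (k : nat) : point3 R :=
  pt (cos ((2 * k)%:R * pi / n%:R)) (sin ((2 * k)%:R * pi / n%:R)) 0.

Definition bipyramid : set (point3 R) :=
  convex_hull (range pole `|` [set equatorial k | k in [set k | (k < n)%N]]).

Definition rotation_z (t : R) : 'M[R]_3 :=
  mx3 [:: [:: cos t; - sin t; 0]; [:: sin t; cos t; 0]; [:: 0; 0; 1]].

Definition reflection_z : 'M[R]_3 :=
  mx3 [:: [:: 1; 0; 0]; [:: 0; 1; 0]; [:: 0; 0; -1]].

Definition reflection_y : 'M[R]_3 :=
  mx3 [:: [:: 1; 0; 0]; [:: 0; -1; 0]; [:: 0; 0; 1]].

Definition prismatic_group : set 'M[R]_3 :=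
  generated_isometries
    [set rotation_z (2 * pi / n%:R); reflection_z; reflection_y].

(** [g] stabilizes the triangle [F] and induces on it the reflection fixing
    the pole and swapping the two equatorial vertices. *)
Definition induces_reflection (g : 'M[R]_3) (F : set (point3 R)) : Prop :=
  mximage g F = F /\
  exists (s : bool) (i j : nat),
    [/\ (i < n)%N, (j < n)%N & i != j] /\
    [/\ F (pole s), F (equatorial i) & F (equatorial j)] /\
    [/\ g *m pole s = pole s,
        g *m equatorial i = equatorial j
      & g *m equatorial j = equatorial i].

End Bipyramid.

Arguments prismatic_group R n : clear implicits.

(* Main.v *)
Require Import Defs.
From HB Require Import structures.
From mathcomp Require Import all_boot all_order all_algebra all_fingroup all_solvable.
From mathcomp Require Import all_classical all_reals all_analysis.
From mathcomp Require Import ring lra zify.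

Set Implicit Arguments.
Unset Strict Implicit.
Unset Printing Implicit Defensive.

Import Order.TTheory GRing.Theory Num.Theory.

(** The number of orbits is given by Burnside's lemma, once the tilings
    unchanged by each of the [4n] symmetries are counted.

    A tiling is a section of the projection [T * faces -> faces], and the
    symmetries act on both sides.  A section invariant under a group [H] is
    obtained by choosing, for one face in each [H]-orbit, a design fixed by the
    stabiliser of that face in [H]; the designs of the other faces of the orbit
    are then forced ([card_fixed_sections]).  With [H] generated by a single
    symmetry [g], three kinds of symmetries appear:
    - rotations of order [d], composed or not with the exchange of the poles:
      the nontrivial powers of [g] move every face: all orbits have [d] elements,
      respectively [lcm (d, 2)], and there are [totient d] rotations of order
      [d] ([sum_order_cyclic]);
    - half-turns about a horizontal axis: they exchange the poles, so all orbits
      have 2 elements;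
    - reflections in a vertical plane: they fix the faces cut by this plane
      through the middle of their base, and exchange the others in pairs.
      The face after the vertex [j] is fixed by the reflection [i |-> k - i] of
      the equator when [2j + 1 = k] modulo [n], which has one solution [j] for
      [n] odd, and two or none, equally often, for [n] even.  The stabiliser
      of a face has order 2 and the faces form one orbit, so any nontrivial symmetry
      fixing a face is conjugate to the reflection [f] and fixes [tf] designs
      ([card_bto_fixed]).

    The group is thus handled as an abstract group [prism] acting on pairs (edge
    of the equator, pole).  Two facts connect it with the solid.  The matrices
    generated by the three given isometries are those of [prism]
    ([prismatic_groupE]).  And the faces, defined by supporting planes, are the
    [2n] expected triangles ([face_atP]): an affine equation satisfied by the
    vertices on a supporting plane is satisfied by the whole face, which has
    dimension 2, so it is proportional to the equation of the plane
    ([face_equation]); this excludes any plane with too few vertices. *)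

(** * Equivariant sections *)

(** Sections of the projection [T * X -> X] are represented by functions from
    [X] to [T].  The action [bto] on [T * X] lies over the action [to], and it
    moves a section by moving its graph. *)
Section EquivariantSections.
Local Open Scope group_scope.

Variables (gT : finGroupType) (X T : finType).
Variables (to : {action gT &-> X}) (bto : {action gT &-> T * X}).
Hypothesis bto_over : forall t x g, (bto (t, x) g).2 = to x g.

Implicit Types (tau sigma : {ffun X -> T}) (g h : gT) (x y : X) (H : {group gT}).

Definition transport tau g : {ffun X -> T} :=
  [ffun y => (bto (tau (to y g^-1), to y g^-1) g).1].

Lemma transportE tau g x : bto (tau x, x) g = (transport tau g (to x g), to x g).
Proof. by rewrite ffunE actK -(bto_over (tau x)) -surjective_pairing. Qed.

Lemma transport_unique tau sigma g :
  (forall x, bto (tau x, x) g = (sigma (to x g), to x g)) -> sigma = transport tau g.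
Proof.
move=> sigE; apply/ffunP=> y.
by have := sigE (to y g^-1); rewrite transportE actKV => -[].
Qed.

Lemma transport_is_action : is_action [set: gT] transport.
Proof.
apply: is_total_action => [tau | tau g h]; first last.
  by symmetry; apply: transport_unique => x; rewrite !actM transportE transportE.
by symmetry; apply: transport_unique => x; rewrite !act1.
Qed.

Canonical transport_action := Action transport_is_action.

Lemma transport_fixP tau g :
  reflect (forall x, bto (tau x, x) g = (tau (to x g), to x g))
          (transport tau g == tau).
Proof.
apply: (iffP eqP) => [tauE x | /transport_unique //].
by rewrite transportE tauE.
Qed.

Variable H : {group gT}.

(** The value of [pick] only depends on the orbit, which makes it a canonical
    point of this orbit. *)
Definition orbit_repr x := odflt x [pick y in orbit to H x].

Definition stab_fixed x : {pred T} :=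
  [pred t | [forall h in 'C_H[x | to], bto (t, x) h == (t, x)]].

Lemma orbit_reprP x : orbit_repr x \in orbit to H x.
Proof.
by rewrite /orbit_repr; case: pickP => //= _; apply: orbit_refl.
Qed.

Lemma eq_orbit_repr x y : y \in orbit to H x -> orbit_repr y = orbit_repr x.
Proof.
move=> yx; rewrite /orbit_repr (orbit_eqP yx).
by case: pickP => //= /(_ y); rewrite yx.
Qed.

Lemma orbit_repr_idem x : orbit_repr (orbit_repr x) = orbit_repr x.
Proof. exact/eq_orbit_repr/orbit_reprP. Qed.

Lemma orbit_reprE x y : (orbit_repr y == orbit_repr x) = (y \in orbit to H x).
Proof.
apply/eqP/idP=> [yx | /eq_orbit_repr //].
rewrite -(orbit_eqP (orbit_reprP x)) -yx orbit_sym.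
exact: orbit_reprP.
Qed.

Lemma sum_card_orbit : (\sum_(x | orbit_repr x == x) #|orbit to H x| = #|X|)%N.
Proof.
rewrite -sum1_card.
rewrite [RHS](partition_big orbit_repr (fun x => orbit_repr x == x)) /=; last first.
  by move=> x _; rewrite orbit_repr_idem.
apply: eq_bigr => x /eqP rx; rewrite sum1dep_card; apply: eq_card => y.
by rewrite !inE -orbit_reprE rx.
Qed.

Let S := {x in [pred x | orbit_repr x == x]}.

(** An invariant section is determined by its values at the chosen points of
    the orbits, and there it can take any value fixed by the stabiliser: the
    value elsewhere in the orbit is then forced, without ambiguity. *)
Lemma card_fixed_sections :
  #|'Fix_transport_action(H)| = (\prod_(x | orbit_repr x == x) #|stab_fixed x|)%N.
Proof.
pose res tau : {ffun S -> T} := [ffun u : S => tau (val u)].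
have fixE tau : tau \in 'Fix_transport_action(H) ->
    forall h x, h \in H -> bto (tau x, x) h = (tau (to x h), to x h).
  by move=> /afixP fx h x /fx /eqP/transport_fixP.
have inj_res : {in 'Fix_transport_action(H) &, injective res}.
  move=> tau sigma /fixE tauF /fixE sigF /ffunP eqr; apply/ffunP => x.
  have := orbit_reprP x; rewrite orbit_sym => /orbitP[h Hh hx].
  have eqx : tau (orbit_repr x) = sigma (orbit_repr x).
    by have := eqr (exist _ (orbit_repr x) (introT eqP (orbit_repr_idem x))); rewrite !ffunE.
  by have := tauF _ (orbit_repr x) Hh; rewrite eqx sigF // hx => -[].
rewrite -(card_in_image inj_res).
have -> : #|[seq res tau | tau in 'Fix_transport_action(H)]| =
          #|(family (fun u : S => stab_fixed (val u)) : {pred {ffun S -> T}})|.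
  apply: eq_card => rho; apply/fintype.imageP/familyP => [[tau /fixE tauF ->] u | rhoF].
    rewrite inE; apply/forall_inP => h /setIP[Hh]; rewrite ffunE => /astab1P hu.
    by rewrite tauF // hu.
  (* rebuild the section by moving its values along paths from these points *)
  have /fin_all_exists[path pathP] x : exists h, (h \in H) && (to (orbit_repr x) h == x).
    have := orbit_reprP x; rewrite orbit_sym => /orbitP[h Hh hx].
    by exists h; rewrite Hh hx eqxx.
  pose base x : S := exist _ (orbit_repr x) (introT eqP (orbit_repr_idem x)).
  pose tau := [ffun x => (bto (rho (base x), orbit_repr x) (path x)).1].
  have tauE x : bto (rho (base x), orbit_repr x) (path x) = (tau x, x).
    have /andP[_ /eqP px] := pathP x.
    by rewrite [LHS]surjective_pairing bto_over px ffunE.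
  exists tau; last first.
    apply/ffunP => u; rewrite !ffunE.
    have ru : orbit_repr (val u) = val u by apply/eqP; case: (u).
    have bu : base (val u) = u by apply/val_inj.
    rewrite bu ru; have /andP[Hp /eqP pu] := pathP (val u); rewrite ru in pu.
    have := rhoF u; rewrite inE => /forall_inP/(_ (path (val u)))/(_ _)/eqP -> //.
    by rewrite inE Hp /=; apply/astab1P.
  apply/afixP => h Hh; apply/eqP/transport_fixP => x.
  have rh : orbit_repr (to x h) = orbit_repr x by apply/eq_orbit_repr/mem_orbit.
  have bh : base (to x h) = base x by apply/val_inj.
  have := tauE (to x h); rewrite bh rh => eqh.
  rewrite -tauE -actM -eqh -[_ * h](mulgKV (path (to x h))) actM.
  congr (bto _ _).
  (* two paths to the same point differ by an element of the stabiliser *)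
  have /andP[Hp /eqP px] := pathP x; have /andP[Hq /eqP qx] := pathP (to x h).
  have := rhoF (base x); rewrite inE => /forall_inP/(_ (path x * h * (path (to x h))^-1)).
  move=> /(_ _)/eqP -> //.
  apply/setIP; split; first by rewrite !groupM ?groupV.
  by apply/astab1P; rewrite !actM px -[X in to X _]qx rh actK.
by rewrite card_family foldrE big_image /= (big_sub [pred x | orbit_repr x == x]).
Qed.

(** The orbits outside [A] have [#|H|] elements each, which gives their number,
    and the trivial stabilisers put no constraint on the values there. *)
Lemma card_fixed_sections_semiregular (A : {set X}) k :
    (forall x, x \in A -> x \in 'Fix_to(H) /\ #|stab_fixed x| = k) ->
    (forall x, x \notin A -> 'C_H[x | to] = 1) ->
  #|'Fix_transport_action(H)| = (k ^ #|A| * #|T| ^ ((#|X| - #|A|) %/ #|H|))%N.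
Proof.
move=> HA HnA; rewrite card_fixed_sections (bigID (mem A)) /=.
have reprA x : (orbit_repr x == x) && (x \in A) = (x \in A).
  rewrite andbC; have [/HA[/orbit1P fx _] /=|//] := boolP (x \in A).
  by have := orbit_reprP x; rewrite fx => /set1P ->; rewrite eqxx.
rewrite (eq_bigl _ _ reprA) (eq_bigr (fun=> k)) => [|x /HA[]//].
rewrite prod_nat_const; congr (_ * _)%N.
pose B := [set x | (orbit_repr x == x) && (x \notin A)].
have inB x : (orbit_repr x == x) && (x \notin A) = (x \in B) by rewrite inE.
rewrite (eq_bigl _ _ inB) (eq_bigr (fun=> #|T|)) => [|x].
  rewrite prod_nat_const; congr (_ ^ _)%N.
  have := sum_card_orbit; rewrite (bigID (mem A)) /= (eq_bigl _ _ reprA).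
  rewrite (eq_bigr (fun=> 1%N)) => [|x /HA[]]; last first.
    by move=> /orbit1P ->; rewrite cards1.
  rewrite sum1_card [X in (_ + X)%N](eq_bigr (fun=> #|H|)); last first.
    by move=> x /andP[_ /HnA stab1]; rewrite card_orbit stab1 indexg1.
  rewrite (eq_bigl _ _ inB) sum_nat_const => <-.
  by rewrite addKn mulnK.
rewrite inE => /andP[_ /HnA stab1].
apply: eq_card => t; rewrite !inE; apply/forall_inP => h.
by rewrite stab1 => /set1P ->; rewrite act1.
Qed.

End EquivariantSections.

(** * Orders in cyclic groups *)

Section CyclicOrders.
Local Open Scope group_scope.
Variables (gT : finGroupType) (G : {group gT}).
Hypothesis cycG : cyclic G.

(** The elements of order [d] are the generators of the unique subgroup of
    order [d]. *)
Lemma card_order_cyclic d :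
  (d %| #|G|)%N -> #|[set x in G | #[x] == d]| = totient d.
Proof.
have /cyclicP[a Ga] := cycG; rewrite Ga => da.
have subE := cycle_sub_group da; set b := a ^+ _ in subE.
have ob : #[b] = d.
  by have /setP/(_ <[b]>%G) := subE; rewrite !inE eqxx => /andP[_ /eqP].
rewrite -ob totient_gen; apply: eq_card => x; rewrite !inE /generator ob.
have /setP/(_ <[x]>%G) := subE; rewrite !inE /= cycle_subG /order => ->.
by rewrite -val_eqE /= eq_sym.
Qed.

Lemma sum_order_cyclic (F : nat -> nat) :
  (\sum_(x in G) F #[x] = \sum_(d <- divisors #|G|) totient d * F d)%N.
Proof.
pose h (x : gT) : 'I_#|G|.+1 := inord #[x].
have hE x : x \in G -> h x = #[x] :> nat.
  by move=> Gx; rewrite inordK // ltnS dvdn_leq ?order_dvdG.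
rewrite (partition_big h (fun d => (d %| #|G|)%N)) /=; last first.
  by move=> x Gx; rewrite hE // order_dvdG.
rewrite -(big_mkord (fun d => (d %| #|G|)%N) (fun d => \sum_(i in G | h i == d :> nat) F #[i]))%N.
rewrite -big_filter.
have -> : [seq i <- index_iota 0 #|G|.+1 | (i %| #|G|)%N] = divisors #|G|.
  apply: (sorted_eq (leT := ltn)) => //; first exact: ltn_trans.
  - by move=> i j /andP[/ltnW ij /ltnW ji]; apply/eqP; rewrite eqn_leq ij.
  - by rewrite sorted_filter ?iota_ltn_sorted //; apply: ltn_trans.
  - exact: sorted_divisors_ltn.
  apply: uniq_perm; rewrite ?filter_uniq ?iota_uniq ?divisors_uniq // => d.
  rewrite mem_filter mem_index_iota -dvdn_divisors // ltnS andbC.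
  by apply: andb_idl => /dvdn_leq->.
apply: eq_big_seq => d; rewrite -dvdn_divisors // => dG.
rewrite -card_order_cyclic // -sum1dep_card big_distrl /=.
apply: eq_big => [x | x /andP[Gx /eqP]].
  by apply: andb_id2l => Gx; rewrite hE.
by rewrite mul1n hE // => ->.
Qed.

End CyclicOrders.

(** * The prismatic group acting on the faces *)

(** For [n = p.+3], the element [(k, a, b)] moves the equatorial vertex [j] to
    [k + j], or to [k - j] when [b], and exchanges the poles when [a].  The form
    [p.+3] makes ['I_n] a ring. *)
Definition prism (p : nat) : Type := ('I_p.+3 * bool * bool)%type.

Section Prism.
Variable p : nat.
Local Notation n := p.+3.
Local Notation V := 'I_n.
Local Notation G := (prism p).
Local Open Scope ring_scope.

Implicit Types (g h : G) (k j : V) (a b s : bool).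

HB.instance Definition _ := Finite.copy G (V * bool * bool)%type.

Definition prism_turn g : V := g.1.1.
Definition prism_flip g : bool := g.1.2.
Definition prism_mirror g : bool := g.2.

Definition signed b k : V := if b then - k else k.

(** Products are composed from left to right, so that the group acts on the
    right, as required by [is_action]. *)
Definition prism_mul g h : G :=
  (prism_turn h + signed (prism_mirror h) (prism_turn g),
   prism_flip g (+) prism_flip h, prism_mirror g (+) prism_mirror h).

Definition prism_inv g : G :=
  (- signed (prism_mirror g) (prism_turn g), prism_flip g, prism_mirror g).

Fact prism_mulA : associative prism_mul.
Proof.
move=> [[k a] b] [[k' a'] b'] [[k2 a2] b2]; rewrite /prism_mul /=.
rewrite !addbA; congr (_, _, _); rewrite /prism_turn /prism_mirror /=.
by case: b' b2 => [] [] /=; ring.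
Qed.

Fact prism_mul1 : left_id (0, false, false) prism_mul.
Proof.
move=> [[k a] b]; rewrite /prism_mul /prism_turn /prism_mirror /=.
by case: b; rewrite /= ?oppr0 addr0.
Qed.

Fact prism_mulV : left_inverse (0, false, false) prism_inv prism_mul.
Proof.
move=> [[k a] b]; rewrite /prism_mul /prism_inv /prism_turn /prism_mirror /= !addbb.
by congr (_, _, _); case: b => /=; ring.
Qed.

HB.instance Definition _ := Finite_isGroup.Build G prism_mulA prism_mul1 prism_mulV.

Lemma prism1E : 1%g = (0, false, false) :> G. Proof. by []. Qed.

Lemma prismME k a b k' a' b' :
  (((k, a, b) : G) * ((k', a', b') : G))%g = (k' + signed b' k, a (+) a', b (+) b') :> G.
Proof. by []. Qed.

(** The face [(j, s)] joins the pole [s] to the edge from [j] to [j + 1]; when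
    [b], this edge goes to the one from [k - j - 1] to [k - j]. *)
Definition face_move (x : V * bool) g : V * bool :=
  (prism_turn g + (if prism_mirror g then - x.1 - 1 else x.1), x.2 (+) prism_flip g).

Lemma face_moveE j s k a b :
  face_move (j, s) (k, a, b) = (k + (if b then - j - 1 else j), s (+) a).
Proof. by []. Qed.

Fact face_move_is_action : is_action [set: G] face_move.
Proof.
apply: is_total_action => [[j s] | [j s] [[k a] b] [[k' a'] b']].
  by rewrite prism1E face_moveE add0r addbF.
rewrite prismME !face_moveE addbA; congr (_, _).
by case: b b' => [] []; rewrite /signed /=; ring.
Qed.

Canonical face_action := Action face_move_is_action.

Lemma card_prism : #|[set: G]| = (4 * p.+3)%N.
Proof. by rewrite cardsT !card_prod card_ord !card_bool; lia. Qed.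

Lemma face_trans x y : exists g, face_action x g = y.
Proof.
case: x y => [j s] [j' s']; exists (j' - j, s (+) s', false).
by rewrite [LHS]face_moveE addKb; congr (_, _); apply: subrK.
Qed.

(** A symmetry keeping the pole of a face and the edge on its base is the identity
    or reverses this edge. *)
Lemma face_stab x g : face_action x g = x -> g != 1%g ->
  g = (x.1 *+ 2 + 1, false, true).
Proof.
case: x g => [j s] [[k a] b]; rewrite [face_action _ _]face_moveE => -[kj sa].
have -> : a = false by move: sa; case: (s) (a) => [] [].
case: b kj => [kj _ | /(canRL (addrK _))]; last by rewrite subrr => ->.
by congr (_, _, _) => /=; apply/esym; rewrite mulr2n -{1}kj; ring.
Qed.

Lemma prism_rotationX k a m :
  (((k, a, false) : G) ^+ m)%g = (k *+ m, odd m && a, false).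
Proof.
elim: m => [|m IHm]; first by rewrite mulr0n.
by rewrite expgS IHm prismME /= mulrSr; case: a {IHm} (odd m) => [] [].
Qed.

Lemma order_rotation k a :
  #[(k, a, false) : G]%g = if a then lcmn #[k]%g 2 else #[k]%g.
Proof.
have dvdE m : (#[(k, a, false) : G]%g %| m)%N = (#[k]%g %| m)%N && ~~ (odd m && a).
  rewrite !order_dvdn prism_rotationX FinRing.zmodXgE prism1E.
  by rewrite !xpair_eqE eqxx andbT eqbF_neg.
apply/eqP; rewrite eqn_dvd; case: a dvdE => dvdE.
  rewrite dvdE dvdn_lcml andbT -dvdn2 dvdn_lcmr dvdn_lcm /=.
  by have := dvdE #[(k, true, false) : G]%g; rewrite dvdnn andbT -dvdn2 => /esym.
rewrite dvdE dvdnn andbF /=.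
by have := dvdE #[(k, false, false) : G]%g; rewrite dvdnn andbF andbT => /esym.
Qed.

Lemma order_mirror k a : #[(k, a, true) : G]%g = 2.
Proof.
apply: nt_prime_order => //; first by rewrite expgS expg1 prismME /= addbb /signed addrN.
by rewrite prism1E xpair_eqE andbF.
Qed.

(** The indices [j] of the faces [(j, s)] fixed by the reflection
    [(k, false, true)]: the edge from [j] to [j + 1] is reversed. *)
Definition mirror_faces k : {set V} := [set j | j *+ 2 + 1 == k].

Lemma sum_card_mirror_faces : (\sum_k #|mirror_faces k| = n)%N.
Proof.
rewrite -[RHS]card_ord -sum1_card [RHS](partition_big (fun j : V => j *+ 2 + 1) xpredT) //=.
by apply: eq_bigr => k _; rewrite -sum1_card; apply: eq_bigl => j; rewrite inE.
Qed.

(** Doubling is injective modulo an odd number. *)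
Lemma card_mirror_faces_odd k : odd n -> #|mirror_faces k| = 1%N.
Proof.
move=> n_odd.
have inj2 : injective (fun j : V => j *+ 2 + 1).
  move=> i j /addIr/eqP; rewrite -subr_eq0 -mulrnBl -FinRing.zmodXgE -order_dvdn => ij2.
  have ijn : (#[(i - j)%R]%g %| n)%N by rewrite -[n]card_ord -cardsT order_dvdG ?inE.
  have := dvdn_gcd #[(i - j)%R]%g n 2; rewrite ijn ij2.
  have /eqP -> : coprime n 2 by rewrite coprimen2.
  by rewrite dvdn1 order_eq1 subr_eq0 => /eqP.
have [g gK Kg] := injF_bij inj2.
rewrite -[RHS](cards1 (g k)); apply: eq_card => j; rewrite !inE.
by apply/eqP/eqP => [<- | ->]; rewrite ?gK ?Kg.
Qed.

(** Doubling is two-to-one modulo an even number. *)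
Lemma card_mirror_faces_even k : ~~ odd n ->
  #|mirror_faces k| = 0%N \/ #|mirror_faces k| = 2%N.
Proof.
move=> n_even; have n2 : (n./2 * 2 = n)%N by rewrite muln2 even_halfK.
have ltq : (n./2 < n)%N by lia.
pose q : V := Ordinal ltq.
have dbl (z : V) : z *+ 2 = 0 -> z = 0 \/ z = q.
  rewrite Zp_mulrn => /(congr1 val)/eqP; rewrite /= -[(_ %% _ == 0)%N]/(n %| z * 2)%N.
  rewrite -{1}n2 dvdn_pmul2r // => /dvdnP[c zc].
  have := ltn_ord z; case: c zc => [|[|c]] zc zn.
  - by left; apply: val_inj.
  - by right; apply: val_inj; rewrite /= zc mul1n.
  by rewrite mulSn mulSn in zc; lia.
have q2 : q *+ 2 = 0 by apply: val_inj; rewrite Zp_mulrn /= n2 modnn.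
have [-> | [j]] := set_0Vmem (mirror_faces k); first by rewrite cards0; left.
rewrite inE => /eqP jk; right.
have -> : mirror_faces k = [set j; q + j]%SET.
  apply/setP => i; rewrite !inE -jk; apply/eqP/orP => [/addIr/eqP | [/eqP-> //|/eqP->]].
    rewrite -subr_eq0 -mulrnBl => /eqP/dbl[/eqP | <-]; last by right; rewrite subrK.
    by rewrite subr_eq0 => ->; left.
  by rewrite mulrnDl q2 add0r.
by rewrite cards2 -[X in X == _]add0r (inj_eq (addIr j)) -val_eqE /=; lia.
Qed.

(** As the numbers of solutions are 0 or 2 and sum to [n], each occurs [n / 2]
    times. *)
Lemma sum_mirror_even (F : nat -> nat) : ~~ odd n ->
  (\sum_k F #|mirror_faces k| = n./2 * F 0 + n./2 * F 2)%N.
Proof.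
move=> n_even; pose E := [set k | #|mirror_faces k| == 2]%SET.
have inE2 k : #|mirror_faces k| = (if k \in E then 2 else 0)%N.
  by rewrite inE; case: (card_mirror_faces_even k n_even) => ->.
have cardE : #|E| = n./2.
  have := sum_card_mirror_faces; rewrite (eq_bigr _ (fun k _ => inE2 k)) -big_mkcond.
  by rewrite sum_nat_const; lia.
have cardEC : #|~: E|%SET = n./2 by have := cardsC E; rewrite card_ord cardE; lia.
move: n./2 cardE cardEC => q cardE cardEC.
rewrite (bigID (mem E)) /= addnC; congr (_ + _)%N.
  rewrite (eq_bigr (fun=> F 0%N)) => [|k /negPf kE]; last by rewrite inE2 kE.
  rewrite -[in RHS]cardEC -sum_nat_const; apply: eq_bigl => k.
  by rewrite finset.in_setC.
rewrite (eq_bigr (fun=> F 2)) => [|k kE]; last by rewrite inE2 kE.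
by rewrite -[in RHS]cardE -sum_nat_const.
Qed.

Lemma sum_rotation_orders (F : nat -> nat) :
  (\sum_(k : V) F #[k]%g = \sum_(d <- divisors n) totient d * F d)%N.
Proof.
have VE : [set: V] = <[Zp1]>%g := Zp_cycle p.+2.
have cycV : cyclic [set: V] by rewrite VE cycle_cyclic.
by rewrite -[n in divisors n]card_ord -cardsT -sum_order_cyclic //; apply: eq_bigl => k; rewrite inE.
Qed.

Lemma sum_prism (F : G -> nat) :
  (\sum_g F g =
   \sum_k (F (k, true, true) + F (k, true, false)
           + (F (k, false, true) + F (k, false, false))))%N.
Proof.
transitivity (\sum_k \sum_a \sum_b F (k, a, b))%N.
  by rewrite pair_bigA pair_bigA /=; apply: eq_bigr => [[[k a] b]] _.
by apply: eq_bigr => k _; rewrite !big_bool.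
Qed.

End Prism.

(** * Counting tilings of the combinatorial bipyramid *)

Section PrismTilings.
Variables (p : nat) (T : finType).
Local Notation n := p.+3.
Local Notation V := 'I_n.
Local Notation G := (prism p).
Variable bto : {action G &-> T * (V * bool)}.
Hypothesis bto_over : forall t x g, (bto (t, x) g).2 = face_action p x g.
Local Notation move := (transport_action bto_over).
Local Notation Fix g := ('Fix_move[g])%g.
Local Open Scope ring_scope.

Implicit Types (g h : G) (x : V * bool) (k j : V).

Definition bto_fixed x g : {pred T} := [pred t | bto (t, x) g == (t, x)].

Lemma stab_fixed_cycle x g : face_action p x g = x ->
  #|stab_fixed (face_action p) bto <[g]> x| = #|bto_fixed x g|.
Proof.
move=> gx; apply: eq_card => t; rewrite !inE.
apply/forall_inP/eqP => [/(_ g) | tg h].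
  move=> tg; apply/eqP/tg; rewrite inE cycle_id; exact/astab1P.
case/setIP=> /cycleP[i ->] _; apply/eqP.
by elim: i => [|i IHi]; rewrite ?act1 // expgSr actM IHi.
Qed.

(** Moving a face by [h] transports its designs fixed by [g] to those fixed by
    the conjugate of [g]. *)
Lemma card_bto_fixed_conj x g h :
  #|bto_fixed (face_action p x h) (g ^ h)%g| = #|bto_fixed x g|.
Proof.
have moveE y t u : bto (t, y) u = ((bto (t, y) u).1, face_action p y u).
  by rewrite [LHS]surjective_pairing bto_over.
pose up t := (bto (t, x) h).1; pose down t := (bto (t, face_action p x h) (h^-1)%g).1.
have upK : cancel up down.
  by move=> t; rewrite /up /down -moveE actK.
have downK : cancel down up.
  move=> t; rewrite /up /down.
  have := moveE (face_action p x h) t (h^-1)%g; rewrite actK => <-.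
  by rewrite actKV.
rewrite -[LHS]cardsE -[RHS]cardsE -(on_card_preimset (f := up)); last by exists down => t _.
apply: eq_card => t; rewrite !inE /up -moveE.
by rewrite /conjg !actM actK (inj_eq (act_inj bto h)).
Qed.

Variables (x0 : V * bool) (f : G).
Hypotheses (f_neq1 : f != 1%g) (fx0 : face_action p x0 f = x0).

(** A nontrivial symmetry fixing a face is conjugate to [f], by any symmetry
    moving [x0] to this face: the stabilisers have order 2. *)
Lemma card_bto_fixed x g : g != 1%g -> face_action p x g = x ->
  #|bto_fixed x g| = #|bto_fixed x0 f|.
Proof.
move=> g_neq1 gx; have [h hx] := face_trans x0 x.
rewrite -(card_bto_fixed_conj x0 f h) hx; congr #|bto_fixed _ _|.
rewrite (face_stab gx g_neq1); apply/esym/face_stab; last by rewrite conjg_eq1.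
by rewrite -hx /conjg !actM actK fx0.
Qed.

(** A power of [(k, a, false)] fixing one face is the identity. *)
Lemma card_fix_rotation k a :
  #|Fix (k, a, false)| = (#|T| ^ (2 * n %/ (if a then lcmn #[k]%g 2 else #[k]%g)))%N.
Proof.
rewrite -afix_cycle.
rewrite (card_fixed_sections_semiregular bto_over (A := finset.set0) (k := 0)) => [|x|[j s] _].
- rewrite cards0 expn0 mul1n subn0 -[#|<[_]>%g|]/#[_]%g order_rotation.
  by rewrite card_prod card_ord card_bool mulnC.
- by rewrite inE.
apply/trivgP; apply/fintype.subsetP => _ /setIP[/cycleP[i ->] /astab1P].
rewrite prism_rotationX [face_action _ _ _]face_moveE => -[kj sa].
rewrite inE; apply/eqP; rewrite prism1E; congr (_, _, _).
  by apply: (addIr j); rewrite kj add0r.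
by move: sa; case: (s) (odd i && a) => [] [].
Qed.

Lemma card_fix_mirror k a :
  #|Fix (k, a, true)| =
    if a then (#|T| ^ n)%N else
    (#|bto_fixed x0 f| ^ (2 * #|mirror_faces k|) * #|T| ^ (n - #|mirror_faces k|))%N.
Proof.
pose A := if a then finset.set0 else finset.setX (mirror_faces k) [set: bool].
have inA x : (x \in A) = (face_action p x (k, a, true) == x).
  case: x => j s; rewrite [face_action _ _ _]face_moveE xpair_eqE /A.
  case: a A; first by rewrite inE addbT; case: s; rewrite andbF.
  rewrite !inE /= addbF eqxx !andbT mulr2n => _.
  by apply/eqP/eqP => [<- | {2}<-]; ring.
rewrite -afix_cycle.
rewrite (card_fixed_sections_semiregular bto_over (A := A) (k := #|bto_fixed x0 f|)).
- rewrite -[#|<[_]>%g|]/#[_]%g order_mirror card_prod card_ord card_bool /A.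
  case: (a); first by rewrite cards0 mul1n subn0 mulnK.
  by rewrite cardsX cardsT card_bool -mulnBl mulnK // [X in (_ ^ X * _)%N]mulnC.
- move=> x; rewrite inA => /eqP gx; split.
    by rewrite afix_cycle; apply/afix1P.
  rewrite stab_fixed_cycle // card_bto_fixed //.
  by rewrite -order_eq1 order_mirror.
move=> x; rewrite inA => gx; apply/trivgP; apply/fintype.subsetP => h /setIP[].
rewrite /= cycle2g ?order_mirror // => /set2P[-> | ->]; first by rewrite inE.
by move=> /astab1P/eqP; rewrite (negPf gx).
Qed.

Local Notation tid := #|T|.
Local Notation tf := #|bto_fixed x0 f|.

Lemma card_tiling_orbits :
  (#|orbit move [set: G] @: [set: {ffun V * bool -> T}]| * (4 * n) =
   n * tid ^ n
   + \sum_(k : V) tf ^ (2 * #|mirror_faces k|) * tid ^ (n - #|mirror_faces k|)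
   + \sum_(d <- divisors n)
       (totient d * tid ^ (2 * n %/ d) + totient d * tid ^ (2 * n %/ lcmn d 2)))%N.
Proof.
rewrite -card_prism -Frobenius_Cauchy; last by apply/actsP=> g _ tau; rewrite !inE.
rewrite (eq_bigl xpredT) => [|g]; last by rewrite inE.
rewrite (eq_bigr (fun g => #|Fix g|)) => [|g _]; last by rewrite finset.setTI.
rewrite sum_prism !big_split /= -!sum_rotation_orders.
under eq_bigr do rewrite card_fix_mirror.
under [X in (_ + X + _)%N]eq_bigr do rewrite card_fix_rotation.
under [X in (_ + (X + _))%N]eq_bigr do rewrite card_fix_mirror.
under [X in (_ + (_ + X))%N]eq_bigr do rewrite card_fix_rotation.
rewrite sum_nat_const card_ord -[LHS]addnA -[RHS]addnA; congr (_ + _)%N.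
by rewrite [LHS]addnC -addnA.
Qed.

End PrismTilings.

(** * The regular polygon on the equator *)

Local Open Scope classical_set_scope.
Local Open Scope ring_scope.

Section RootsOfUnity.
Variables (R : realType) (p : nat).
Local Notation n := p.+3.
Implicit Types (k l i j : 'I_n).

Definition cosk k : R := cos ((2 * k)%:R * pi / n%:R).
Definition sink k : R := sin ((2 * k)%:R * pi / n%:R).
Definition cos_half : R := cos (pi / n%:R).
Definition sin_half : R := sin (pi / n%:R).

Let n_neq0 : n%:R != 0 :> R. Proof. by rewrite pnatr_eq0. Qed.

Let angleD (k l : nat) :
  (2 * (k + l))%:R * pi / n%:R = (2 * k)%:R * pi / n%:R + (2 * l)%:R * pi / n%:R :> R.
Proof. by rewrite mulnDr natrD; field. Qed.

Let angle_mod (k : nat) : exists m,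
  (2 * k)%:R * pi / n%:R = (2 * (k %% n))%:R * pi / n%:R + (pi *+ 2) *+ m :> R.
Proof.
exists (k %/ n)%N; rewrite {1}(divn_eq k n) addnC angleD; congr (_ + _).
by rewrite -mulrnA -mulr_natr !natrM; field.
Qed.

(** [cosk] and [sink] form a homomorphism from ['I_n] to the circle, which
    reduces the trigonometry of the vertices to ring identities. *)
Lemma coskD k l : cosk (k + l) = cosk k * cosk l - sink k * sink l.
Proof.
rewrite /cosk /sink -cosD -angleD; have [m ->] := angle_mod (k + l).
by rewrite (periodicn (@cosD2pi R)).
Qed.

Lemma sinkD k l : sink (k + l) = sink k * cosk l + cosk k * sink l.
Proof.
rewrite /cosk /sink -sinD -angleD; have [m ->] := angle_mod (k + l).
by rewrite (periodicn (@sinD2pi R)).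
Qed.

Lemma cosk0 : cosk 0 = 1. Proof. by rewrite /cosk muln0 !mul0r cos0. Qed.
Lemma sink0 : sink 0 = 0. Proof. by rewrite /sink muln0 !mul0r sin0. Qed.

Lemma cosk2Dsink2 k : cosk k ^+ 2 + sink k ^+ 2 = 1.
Proof. exact: cos2Dsin2. Qed.

Lemma coskN k : cosk (- k) = cosk k.
Proof.
have := coskD k (- k); have := sinkD k (- k); rewrite subrr cosk0 sink0 => s0 c1.
rewrite -[LHS]mul1r -(cosk2Dsink2 k) -[RHS]mulr1 c1 -[RHS]addr0 -[X in _ = _ + X](mulr0 (sink k)) s0.
ring.
Qed.

Lemma sinkN k : sink (- k) = - sink k.
Proof.
have := coskD k (- k); have := sinkD k (- k); rewrite subrr cosk0 sink0 coskN => s0 c1.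
rewrite -[LHS]mul1r -(cosk2Dsink2 k) -[RHS]mulr1 c1 -[RHS]addr0 -[X in _ = _ + X](mulr0 (cosk k)) s0.
ring.
Qed.

Lemma cos_half2Dsin_half2 : cos_half ^+ 2 + sin_half ^+ 2 = 1.
Proof. exact: cos2Dsin2. Qed.

Lemma cos_half_gt0 : 0 < cos_half.
Proof.
apply: cos_gt0_pihalf; have pi0 := @pi_gt0 R; apply/andP; split.
  by apply: lt_trans (_ : 0 < _); rewrite ?oppr_lt0 ?divr_gt0 // ltr0n.
by rewrite ltr_pM2l // ltf_pV2 ?posrE ?ltr0n // ltr_nat.
Qed.

Let half_angle (l : nat) : (2 * l)%:R * pi / n%:R = (l%:R * pi / n%:R) *+ 2 :> R.
Proof. by rewrite natrM -mulr_natr; field. Qed.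

Let sin_half_angle_ge0 (l : nat) : (l <= n)%N -> 0 <= sin (l%:R * pi / n%:R : R).
Proof.
move=> ln; apply: sin_ge0_pi; have pi0 := @pi_gt0 R; apply/andP; split.
  by rewrite divr_ge0 ?mulr_ge0 ?ler0n ?pi_ge0.
by rewrite ler_pdivrMr ?ltr0n // mulrC ler_pM2l // ler_nat.
Qed.

Let sin_half_angle_gt0 (l : nat) : (0 < l < n)%N -> 0 < sin (l%:R * pi / n%:R : R).
Proof.
move=> /andP[l0 ln]; apply: sin_gt0_pi; have pi0 := @pi_gt0 R; apply/andP; split.
  by rewrite divr_gt0 ?mulr_gt0 ?ltr0n.
by rewrite ltr_pdivrMr ?ltr0n // mulrC ltr_pM2l // ltr_nat.
Qed.

Lemma sin_half_gt0 : 0 < sin_half.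
Proof. by have := @sin_half_angle_gt0 1 isT; rewrite mul1r. Qed.

Lemma cosk1 : cosk 1 = cos_half ^+ 2 - sin_half ^+ 2.
Proof.
rewrite /cosk half_angle mul1r cos_mulr2n -/cos_half.
by rewrite -[1 in LHS]cos_half2Dsin_half2 mulr2n; ring.
Qed.

Lemma sink1 : sink 1 = cos_half * sin_half *+ 2.
Proof. by rewrite /sink half_angle mul1r sin_mulr2n. Qed.

Lemma cos_half_reflect : cos_half * cosk 1 + sin_half * sink 1 = cos_half.
Proof.
by rewrite cosk1 sink1 -[RHS]mulr1 -cos_half2Dsin_half2 -mulr_natr; ring.
Qed.

Lemma sin_half_reflect : cos_half * sink 1 - sin_half * cosk 1 = sin_half.
Proof.
by rewrite cosk1 sink1 -[RHS]mulr1 -cos_half2Dsin_half2 -mulr_natr; ring.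
Qed.

(** [h] and [g] are the sine and the cosine of half the angle to a vertex other
    than [0]; the last two inequalities express that this half angle lies at
    distance at least [pi / n] from [0] and from [pi]. *)
Lemma half_angleP l : l != 0 ->
  exists h g : R, [/\ 0 < h, cosk l = 1 - 2 * h ^+ 2, sink l = 2 * h * g,
    0 <= h * cos_half - g * sin_half & 0 <= h * cos_half + g * sin_half].
Proof.
move=> l0; have l_gt0 : (0 < l)%N by rewrite lt0n.
exists (sin (l%:R * pi / n%:R)), (cos (l%:R * pi / n%:R)); split.
- by rewrite sin_half_angle_gt0 // l_gt0 ltn_ord.
- by rewrite /cosk half_angle cos_mulr2n cos2sin2 -mulr_natr; ring.
- by rewrite /sink half_angle sin_mulr2n -mulr_natr; ring.
- rewrite -sinB (_ : _ - _ = l.-1%:R * pi / n%:R); last first.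
    by rewrite -[in LHS](prednK l_gt0) mulrS; field.
  by rewrite sin_half_angle_ge0 // (leq_trans (leq_pred _)) // ltnW.
rewrite -sinD (_ : _ + _ = l.+1%:R * pi / n%:R); last by rewrite mulrS; field.
by rewrite sin_half_angle_ge0.
Qed.

Lemma cosk_sink_inj k l : cosk k = cosk l -> sink k = sink l -> k = l.
Proof.
move=> ckl skl; apply/eqP; rewrite -subr_eq0; apply/negPn/negP => /half_angleP.
move=> [h [g [h_gt0 + _ _ _]]]; rewrite coskD coskN sinkN ckl skl mulrN opprK.
by rewrite -!expr2 cosk2Dsink2; nra.
Qed.

End RootsOfUnity.

(** * Coordinates and convex hulls *)

Section Coordinates.
Variable R : realType.
Implicit Types (x y w t u : R) (v : point3 R) (a : 'rV[R]_3).

Definition row3 x y w : 'rV[R]_3 := (pt x y w)^T.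

Lemma row3P a : exists x y w, a = row3 x y w.
Proof.
exists (a 0 0), (a 0 (lift 0 0)), (a 0 (lift 0 (lift 0 0))).
apply/rowP => j; rewrite !mxE.
by case: (unliftP 0 j) => [{}j|] ->; [case: (unliftP 0 j) => [{}j|] ->; rewrite ?ord1|].
Qed.

Lemma ptP v : exists x y w, v = pt x y w.
Proof. by have [x [y [w /(canRL trmxK) ->]]] := row3P v^T; exists x, y, w; rewrite trmxK. Qed.

Lemma pt_inj x y w x' y' w' : pt x y w = pt x' y' w' -> [/\ x = x', y = y' & w = w'].
Proof.
by move=> /colP e; split; [have := e 0|have := e (lift 0 0)|have := e (lift 0 (lift 0 0))];
  rewrite !mxE.
Qed.

Lemma row3_inj x y w x' y' w' :
  row3 x y w = row3 x' y' w' -> [/\ x = x', y = y' & w = w'].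
Proof. by move=> /trmx_inj/pt_inj. Qed.

Lemma scale_row3 t x y w : t *: row3 x y w = row3 (t * x) (t * y) (t * w).
Proof.
apply/rowP => j; rewrite !mxE.
by case: (unliftP 0 j) => [{}j|] ->; [case: (unliftP 0 j) => [{}j|] ->; rewrite ?ord1|].
Qed.

Lemma row3_dot x y w x' y' w' :
  (row3 x y w *m pt x' y' w') 0 0 = x * x' + y * y' + w * w'.
Proof. by rewrite !mxE !big_ord_recl big_ord0 addr0 !mxE addrA. Qed.

Lemma mx3_pt (a11 a12 a13 a21 a22 a23 a31 a32 a33 x y w : R) :
  mx3 [:: [:: a11; a12; a13]; [:: a21; a22; a23]; [:: a31; a32; a33]] *m pt x y w =
  pt (a11 * x + a12 * y + a13 * w) (a21 * x + a22 * y + a23 * w)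
     (a31 * x + a32 * y + a33 * w).
Proof.
apply/colP => i; rewrite !mxE !big_ord_recl big_ord0 addr0 addrA !mxE.
by case: (unliftP 0 i) => [{}i|] ->; [case: (unliftP 0 i) => [{}i|] ->; rewrite ?ord1|].
Qed.

Lemma eq_mx_pt (M N : 'M[R]_3) :
  (forall x y w, M *m pt x y w = N *m pt x y w) -> M = N.
Proof.
move=> MN; apply/trmx_inj/row_matrixP => j; rewrite -!tr_col; congr (_^T).
have [x [y [w wE]]] := ptP (delta_mx j 0).
by rewrite !colE wE MN.
Qed.

Lemma dotDZ a t u v v' :
  (a *m (t *: v + u *: v')) 0 0 = t * (a *m v) 0 0 + u * (a *m v') 0 0.
Proof. by rewrite mulmxDr -!scalemxAr !mxE. Qed.

(** The left kernel of [W] has dimension [3 - 2]. *)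
Lemma annihilator_line (W : 'M[R]_(3, 2)) a a' :
  \rank W = 2 -> a != 0 -> a *m W = 0 -> a' *m W = 0 -> exists t, a' = t *: a.
Proof.
move=> rW a0 /sub_kermxP aW /sub_kermxP a'W; apply/sub_rVP.
apply: submx_trans a'W _.
by rewrite -(geq_leqif (mxrank_leqif_sup aW)) mxrank_ker rW rank_rV a0.
Qed.

Section Hull.
Variable S : set (point3 R).

Lemma sub_convex_hull : S `<=` convex_hull S.
Proof. exact: sub_smallest. Qed.

Lemma convex_hull_ind (X : set (point3 R)) :
    (forall v v' t u, 0 < t -> 0 < u -> t + u = 1 ->
      X v -> X v' -> X (t *: v + u *: v')) ->
  S `<=` X -> convex_hull S `<=` X.
Proof.
move=> convX; apply: smallest_sub; apply/convex_setW => v v' vX v'X k k0 k1.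
apply/mem_set; apply: convX; [done | | | exact: set_mem vX | exact: set_mem v'X].
  by rewrite /unstable.onem subr_gt0.
by rewrite /unstable.onem addrC subrK.
Qed.

Lemma convex_hull_conv v v' t u : 0 <= t -> 0 <= u -> t + u = 1 ->
  convex_hull S v -> convex_hull S v' -> convex_hull S (t *: v + u *: v').
Proof.
move=> t0 u0 tu Sv Sv' X [convX SX].
have t1 : t <= 1 by rewrite -tu lerDl.
have := @convX v v' (Itv01 t0 t1) (mem_set (Sv _ (conj convX SX))) (mem_set (Sv' _ (conj convX SX))).
by move=> /set_mem; congr (X (_ + _ *: _)); rewrite /= /unstable.onem -tu addrC addKr.
Qed.

Lemma convex_hull_le a (b : R) : (forall v, S v -> (a *m v) 0 0 <= b) ->
  forall v, convex_hull S v -> (a *m v) 0 0 <= b.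
Proof.
move=> Sab; apply: (@convex_hull_ind (fun v => (a *m v) 0 0 <= b)) => //.
move=> v v' t u t0 u0 tu av av'; rewrite dotDZ -[b]mul1r -tu mulrDl.
by rewrite lerD // ler_pM2l.
Qed.

(** The intersection of the hull with a supporting plane is the hull of the
    points of [S] in that plane.  This form of the fact follows from the
    convexity of the set of points that are strictly below the plane or
    satisfy the second equation: a proper convex combination lies in the plane
    only if both its ends do. *)
Lemma tight_equation a a' (b b' : R) :
    (forall v, S v -> (a *m v) 0 0 <= b) ->
    (forall v, S v -> (a *m v) 0 0 = b -> (a' *m v) 0 0 = b') ->
  forall v, convex_hull S v -> (a *m v) 0 0 = b -> (a' *m v) 0 0 = b'.
Proof.
move=> Sab Stight v Sv.
pose X v := (a *m v) 0 0 <= b /\ ((a *m v) 0 0 = b -> (a' *m v) 0 0 = b').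
suff [] : X v by [].
apply: (@convex_hull_ind X) Sv => [{}v v' t u t0 u0 tu [vb ab] [v'b ab']|{}v Sv].
  rewrite /X !dotDZ; split.
    by rewrite -[b]mul1r -tu mulrDl lerD // ler_pM2l.
  have uE : u = 1 - t by rewrite -tu addrC addKr.
  move=> tight.
  have vE : (a *m v) 0 0 = b.
    apply/eqP; rewrite eq_le vb /= -subr_le0 -(pmulr_rle0 _ t0).
    have : u * ((a *m v') 0 0 - b) <= 0 by rewrite pmulr_rle0 // subr_le0.
    by rewrite uE in tight *; lra.
  have v'E : (a *m v') 0 0 = b.
    by apply: (mulfI (lt0r_neq0 u0)); move: tight; rewrite vE uE; lra.
  by rewrite ab // ab' // -mulrDl tu mul1r.
by split; [apply: Sab | apply: Stight].
Qed.

End Hull.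

Lemma mximage_convex_hull (M : 'M[R]_3) (S : set (point3 R)) v :
  (forall v, S v -> S (M *m v)) -> convex_hull S v -> convex_hull S (M *m v).
Proof.
move=> SM; apply: (@convex_hull_ind S (fun v => convex_hull S (M *m v))) => [|w Sw].
  move=> w w' t u t0 u0 tu Sw Sw'; rewrite mulmxDr -!scalemxAr.
  by apply: convex_hull_conv => //; apply: ltW.
by apply: sub_convex_hull; apply: SM.
Qed.

(** The equation extends from the vertices in the face to the face, which spans
    its plane. *)
Lemma face_equation (S F : set (point3 R)) a a' (b b' : R) :
    a != 0 -> (forall v, S v -> (a *m v) 0 0 <= b) ->
    F = convex_hull S `&` [set v | (a *m v) 0 0 = b] ->
    (exists x y w : point3 R,
        [/\ F x, F y, F w & \rank (row_mx (y - x) (w - x)) = 2%N]) ->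
    (forall v, S v -> (a *m v) 0 0 = b -> (a' *m v) 0 0 = b') ->
  exists t, a' = t *: a /\ b' = t * b.
Proof.
move=> a0 Sab -> [x [y [w [[Sx xb] [Sy yb] [Sw wb] rk]]]] Stight.
have tight := tight_equation Sab Stight.
have mx11 (u : 'rV[R]_3) (q : R) (r s : point3 R) :
    (u *m r) 0 0 = q -> (u *m s) 0 0 = q -> u *m (r - s) = 0.
  move=> ur us; apply/matrixP => i j; rewrite !ord1 mulmxBr mxE [_ 0 0]ur.
  by rewrite !mxE in us *; rewrite us subrr.
have aW : a *m row_mx (y - x) (w - x) = 0.
  by rewrite mul_mx_row !(mx11 a b) ?row_mx0.
have a'W : a' *m row_mx (y - x) (w - x) = 0.
  by rewrite mul_mx_row !(mx11 a' b') ?row_mx0 ?tight.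
have [t a'E] := annihilator_line rk a0 aW a'W.
exists t; split=> //; rewrite -(tight x) // a'E -scalemxAl mxE.
by rewrite [(a *m x) 0 0]xb.
Qed.

End Coordinates.

(** * The faces of the bipyramid *)

Section BipyramidFaces.
Variables (R : realType) (p : nat) (z : R).
Hypothesis z_gt0 : 0 < z.
Local Notation n := p.+3.
Local Notation V := 'I_n.
Local Notation P := (bipyramid n z).
Local Notation c := (@cosk R p).
Local Notation s := (@sink R p).
Local Notation gamma := (cos_half R p).
Local Notation sigma := (sin_half R p).
Implicit Types (k j l : V) (e : bool) (x : V * bool) (g : prism p) (v : point3 R).

Definition vertices : set (point3 R) :=
  range (pole z) `|` [set equatorial R n k | k in [set k | (k < n)%N]].

Lemma poleE e : pole z e = pt 0 0 ((-1) ^+ e * z). Proof. by []. Qed.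
Lemma equatorialE k : equatorial R n k = pt (c k) (s k) 0. Proof. by []. Qed.

Lemma pole_vertex e : vertices (pole z e).
Proof. by left; exists e. Qed.

Lemma equatorial_vertex k : vertices (pt (c k) (s k) 0).
Proof. by right; exists (val k) => //=; apply: ltn_ord. Qed.

Lemma verticesP v : vertices v ->
  (exists e, v = pt 0 0 ((-1) ^+ e * z)) \/ (exists k, v = pt (c k) (s k) 0).
Proof.
case=> [[e _ <-]|[k kn <-]]; first by left; exists e.
by right; exists (Ordinal (kn : (k < n)%N)).
Qed.

(** The radius to the middle of the edge from [k] to [k + 1] makes the angle
    [(2 * k + 1) * pi / n]; [outer_normal (k, e)] is a normal to the face on this
    edge, scaled so that the plane of the face is at level [cos_half]. *)
Definition outer_normal x : 'rV[R]_3 :=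
  row3 (gamma * c x.1 - sigma * s x.1) (gamma * s x.1 + sigma * c x.1)
       ((-1) ^+ x.2 * gamma / z).

Definition face_at x : set (point3 R) :=
  P `&` [set v | (outer_normal x *m v) 0 0 = gamma].

Let z_neq0 : z != 0. Proof. exact: lt0r_neq0. Qed.

Lemma outer_normal_pole x e :
  (outer_normal x *m pt 0 0 ((-1) ^+ e * z)) 0 0 = (-1) ^+ (x.2 (+) e) * gamma.
Proof.
by rewrite row3_dot !mulr0 !add0r signr_addb; field.
Qed.

(** The value at a vertex only depends on its position relative to the face. *)
Lemma outer_normal_equatorial x k :
  (outer_normal x *m pt (c k) (s k) 0) 0 0 =
  gamma * c (k - x.1) + sigma * s (k - x.1).
Proof. by rewrite row3_dot coskD sinkD coskN sinkN; ring. Qed.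

Lemma outer_normal_le x v : vertices v -> (outer_normal x *m v) 0 0 <= gamma.
Proof.
have gamma_gt0 := cos_half_gt0 R p; have sigma_gt0 := sin_half_gt0 R p.
case/verticesP => [[e ->]|[k ->]].
  by rewrite outer_normal_pole mulr_sign; case: (_ (+) _); lra.
rewrite outer_normal_equatorial; move: (k - x.1) => l.
have [-> | /(half_angleP R)] := eqVneq l 0; first by rewrite cosk0 sink0; lra.
by move=> [h [q [h0 -> -> hq _]]]; nra.
Qed.

Lemma outer_normal_neq0 x : outer_normal x != 0.
Proof.
have gamma_gt0 := cos_half_gt0 R p.
apply/eqP => /(congr1 (fun a : 'rV[R]_3 => (a *m pt 0 0 ((-1) ^+ x.2 * z)) 0 0)).
by rewrite outer_normal_pole addbb mul0mx mxE; lra.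
Qed.

Lemma face_at_pole k e : face_at (k, e) (pole z e).
Proof.
split; first by apply: sub_convex_hull; apply: pole_vertex.
by rewrite /= outer_normal_pole addbb mul1r.
Qed.

Lemma face_at_equatorial k e : face_at (k, e) (pt (c k) (s k) 0).
Proof.
split; first by apply: sub_convex_hull; apply: equatorial_vertex.
by rewrite /= outer_normal_equatorial subrr cosk0 sink0; lra.
Qed.

Lemma face_at_equatorialS k e : face_at (k, e) (pt (c (k + 1)) (s (k + 1)) 0).
Proof.
split; first by apply: sub_convex_hull; apply: equatorial_vertex.
by rewrite /= outer_normal_equatorial [k + 1]addrC addrK cos_half_reflect.
Qed.

Lemma sink1_gt0 : 0 < s 1.
Proof.
have gamma_gt0 := cos_half_gt0 R p; have sigma_gt0 := sin_half_gt0 R p.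
by rewrite sink1; nra.
Qed.

Lemma pt_sub (x y w x' y' w' : R) : pt x y w - pt x' y' w' = pt (x - x') (y - y') (w - w').
Proof.
apply/colP => i; rewrite !mxE.
by case: (unliftP 0 i) => [{}i|] ->; [case: (unliftP 0 i) => [{}i|] ->; rewrite ?ord1|].
Qed.

Lemma face_at_is_face x : is_face P (face_at x).
Proof.
case: x => k e; split.
  exists (outer_normal (k, e)), gamma; split=> //; first exact: outer_normal_neq0.
  exact/convex_hull_le/outer_normal_le.
exists (pole z e), (pt (c k) (s k) 0), (pt (c (k + 1)) (s (k + 1)) 0).
split; [exact: face_at_pole | exact: face_at_equatorial | exact: face_at_equatorialS |].
apply/eqP/row_fullP; have s1 := sink1_gt0.
(* a left inverse of the matrix of the two edges, with rows [u] and [w] *)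
pose u := (s 1)^-1 *: row3 (s (k + 1)) (- c (k + 1)) 0.
pose w := (s 1)^-1 *: row3 (- s k) (c k) 0.
exists (col_mx u w).
have cross : s (k + 1) * c k - c (k + 1) * s k = s 1.
  by rewrite sinkD coskD -[RHS]mulr1 -(cosk2Dsink2 R k); ring.
have mx11 (M : 'M[R]_1) q : M 0 0 = q -> M = q%:M.
  by move=> Mq; apply/matrixP => i j; rewrite !ord1 mxE Mq eqxx.
rewrite mul_col_row scalar_mx_block !poleE !pt_sub /u /w !scale_row3.
have s1_neq0 := lt0r_neq0 s1.
rewrite (mx11 (_ *m _) 1); last by rewrite row3_dot -[RHS](mulVf s1_neq0) -[X in _ = _^-1 * X]cross; ring.
rewrite (mx11 (_ *m _) 0); last by rewrite row3_dot; ring.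
rewrite (mx11 (_ *m _) 0); last by rewrite row3_dot; ring.
rewrite (mx11 (_ *m _) 1); last by rewrite row3_dot -[RHS](mulVf s1_neq0) -[X in _ = _^-1 * X]cross; ring.
by rewrite !raddf0.
Qed.

(** By [face_equation], equal faces have proportional outer normals, and these
    have the same level. *)
Lemma face_at_inj : injective face_at.
Proof.
move=> x y xy; have [_ aff] := face_at_is_face x.
have [|t [tN tg]] := face_equation (outer_normal_neq0 x) (@outer_normal_le x) (erefl _) aff
  (a' := outer_normal y) (b' := gamma).
  move=> v Sv vx; have : face_at x v by split=> //; apply: sub_convex_hull.
  by rewrite xy => -[].
have t1 : t = 1 by apply: (mulIf (lt0r_neq0 (cos_half_gt0 R p))); rewrite mul1r.
move: tN; rewrite t1 scale1r => /row3_inj[N1 N2 N3].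
case: x y N1 N2 N3 {xy aff t tg t1} => [k e] [l e'] /= N1 N2 N3.
have cs := cos_half2Dsin_half2 R p.
have -> : k = l.
  apply: (@cosk_sink_inj R).
    rewrite -[LHS]mul1r -[RHS]mul1r -cs.
    transitivity (gamma * (gamma * c k - sigma * s k) + sigma * (gamma * s k + sigma * c k)).
      by ring.
    by rewrite -N1 -N2; ring.
  rewrite -[LHS]mul1r -[RHS]mul1r -cs.
  transitivity (gamma * (gamma * s k + sigma * c k) - sigma * (gamma * c k - sigma * s k)).
    by ring.
  by rewrite -N1 -N2; ring.
congr (_, _); move: N3 => /(mulIf (invr_neq0 z_neq0))/(mulIf (lt0r_neq0 (cos_half_gt0 R p))).
by rewrite -[LHS]mulr1 -[RHS]mulr1 !mulr_sign; case: e e' => [] [] //; lra.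
Qed.

(** A supporting plane meeting the bipyramid in a face passes through an
    equatorial vertex [i] and through a pole, since otherwise all the vertices
    on it would satisfy another linear equation.  Its slope at [i] is then
    limited by the two neighbours of [i], and it must pass through one of them,
    for the same reason. *)
Lemma face_atP F : is_face P F -> exists x, F = face_at x.
Proof.
have gamma_gt0 := cos_half_gt0 R p; have sigma_gt0 := sin_half_gt0 R p.
move=> [[a [b [a_neq0 Pab FE]]] aff].
have Sab v : vertices v -> (a *m v) 0 0 <= b.
  by move=> Sv; apply: Pab; apply: sub_convex_hull.
have eqn a' b' := face_equation (a' := a') (b' := b') a_neq0 Sab FE aff.
have [al [be [ze aE]]] := row3P a.
have dotE (x y w : R) : (a *m pt x y w) 0 0 = al * x + be * y + ze * w by rewrite aE row3_dot.
have [i ai] : exists i, al * c i + be * s i = b.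
  (* otherwise both horizontal coordinates vanish at all vertices of the face *)
  apply: contrapT => no_i.
  have tight_pole v : vertices v -> (a *m v) 0 0 = b -> exists w, v = pt 0 0 w.
    move=> /verticesP[[e -> _]|[k ->]]; first by eexists.
    by rewrite dotE mulr0 addr0 => bk; case: no_i; exists k.
  have [|t [/esym t1 _]] := eqn (row3 1 0 0) 0.
    by move=> v Sv /(tight_pole _ Sv)[w ->]; rewrite row3_dot; ring.
  have [|u [/esym u1 _]] := eqn (row3 0 1 0) 0.
    by move=> v Sv /(tight_pole _ Sv)[w ->]; rewrite row3_dot; ring.
  move: t1 u1; rewrite aE !scale_row3 => /row3_inj[tal tbe _] /row3_inj[ual ube _].
  have : (t * al) * (u * be) = (t * be) * (u * al) by ring.
  by rewrite tal ube tbe mul0r mulr1 => /eqP; rewrite oner_eq0.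
(* [b] and [m] are the components of the normal along the radius to [i] and along
   the tangent *)
pose m := be * c i - al * s i.
have cs := cosk2Dsink2 R i.
have alE : al = b * c i - m * s i.
  by rewrite -[LHS]mulr1 -cs -ai /m; ring.
have beE : be = b * s i + m * c i.
  by rewrite -[LHS]mulr1 -cs -ai /m; ring.
have relE l : al * c (i + l) + be * s (i + l) = b * c l + m * s l.
  rewrite alE beE coskD sinkD -[b in RHS]mulr1 -[m in RHS]mulr1 -cs; ring.
have vertex_le l : b * c l + m * s l <= b.
  by have := Sab _ (equatorial_vertex (i + l)); rewrite dotE mulr0 addr0 relE.
have pole_le e : ze * ((-1) ^+ e * z) <= b.
  by have := Sab _ (pole_vertex e); rewrite poleE dotE !mulr0 !add0r.
have bE : b * gamma ^+ 2 + b * sigma ^+ 2 = b.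
  by rewrite -mulrDr cos_half2Dsin_half2 mulr1.
have slope_le : m * gamma <= b * sigma.
  have := vertex_le 1; rewrite cosk1 sink1 => le1.
  by rewrite -(ler_pM2l sigma_gt0); move: le1; rewrite mulr2n; lra.
have slope_ge : - m * gamma <= b * sigma.
  have := vertex_le (-1); rewrite coskN sinkN cosk1 sink1 => le1.
  by rewrite -(ler_pM2l sigma_gt0); move: le1; rewrite mulr2n; lra.
have b_gt0 : 0 < b.
  have := pole_le false; have := pole_le true; rewrite !mulr_sign /= => le1 le0.
  rewrite lt_def; apply/andP; split; last by lra.
  apply/eqP => b0; move: slope_le slope_ge le0 le1; rewrite b0 => *.
  have m0 : m = 0 by apply: (mulIf (lt0r_neq0 gamma_gt0)); lra.
  have ze0 : ze = 0 by apply: (mulIf z_neq0); lra.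
  move: a_neq0; rewrite aE alE beE b0 m0 ze0 !mul0r subr0 addr0.
  by move=> /eqP; apply; apply/rowP => j; rewrite !mxE; case: j => [[|[|[|?]]] ?].
have [e ze_e] : exists e, ze * ((-1) ^+ e * z) = b.
  (* otherwise the height vanishes at all vertices of the face *)
  apply: contrapT => no_e.
  have [|t [/esym t1 /esym/eqP]] := eqn (row3 0 0 1) 0.
    move=> v /verticesP[[e ->]|[k -> _]]; last by rewrite row3_dot; ring.
    by rewrite dotE !mulr0 !add0r => bk; case: no_e; exists e.
  rewrite mulf_eq0 (gt_eqF b_gt0) orbF => /eqP t0.
  move: t1; rewrite t0 scale0r => /matrixP/(_ 0 (lift 0 (lift 0 0))).
  by rewrite !mxE /= => /esym/eqP; rewrite oner_eq0.
have zeE : ze = (-1) ^+ e * b / z.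
  by rewrite -ze_e [ze * _]mulrCA signrMK mulfK.
have [neighbour | /not_orP[not_next not_prev]] :=
    pselect (m * gamma = b * sigma \/ - m * gamma = b * sigma); last first.
  (* otherwise [i] is the only equatorial vertex of the face, whose vertices all
     lie in the vertical plane through [i] and the poles *)
  have tight_i l : l != 0 -> b * c l + m * s l < b.
    move=> /(half_angleP R)[h [q [h0 -> -> hq1 hq2]]].
    have lt1 : m * gamma < b * sigma by rewrite lt_neqAle slope_le andbT; apply/eqP.
    have lt2 : - m * gamma < b * sigma by rewrite lt_neqAle slope_ge andbT; apply/eqP.
    have : 0 < sigma * (b * h - m * q) by have [m0|m0] := lerP 0 m; nra.
    by rewrite pmulr_rgt0 //; nra.
  have [|t [/esym t1 /esym/eqP]] := eqn (row3 (- s i) (c i) 0) 0.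
    move=> v /verticesP[[e' -> _]|[k ->]]; first by rewrite row3_dot; ring.
    have [l ->] : exists l, k = i + l by exists (k - i); rewrite addrC subrK.
    rewrite dotE mulr0 addr0 relE.
    have [-> _ | /tight_i + lb] := eqVneq l 0; last by rewrite lb ltxx.
    by rewrite addr0 row3_dot; ring.
  rewrite mulf_eq0 (gt_eqF b_gt0) orbF => /eqP t0.
  move: t1; rewrite t0 aE scale_row3 !mul0r => /row3_inj[/esym/eqP + ci0 _].
  by rewrite oppr_eq0 => /eqP si0; move: cs; rewrite -ci0 si0; lra.
have [x xE] : exists x, outer_normal x = (gamma / b) *: a.
  have b_neq0 := lt0r_neq0 b_gt0.
  have scaled x : gamma * c x.1 - sigma * s x.1 = gamma / b * al ->
      gamma * s x.1 + sigma * c x.1 = gamma / b * be -> x.2 = e ->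
      outer_normal x = (gamma / b) *: a.
    move=> e1 e2 e3; rewrite aE scale_row3 /outer_normal e1 e2 e3 zeE.
    by congr row3; field; rewrite b_neq0 z_neq0.
  case: neighbour => slope; [exists (i, e) | exists (i - 1, e)]; apply: scaled => //=.
  - have -> : sigma = m * gamma / b by rewrite slope mulrC mulKf.
    by rewrite alE; field.
  - have -> : sigma = m * gamma / b by rewrite slope mulrC mulKf.
    by rewrite beE; field.
  - transitivity (gamma * c i + sigma * s i).
      rewrite -[in RHS](sin_half_reflect R p) -[X in _ = X * _ + _](cos_half_reflect R p).
      by rewrite coskD sinkD coskN sinkN; ring.
    have -> : sigma = - m * gamma / b by rewrite slope mulrC mulKf.
    by rewrite alE; field.
  transitivity (gamma * s i - sigma * c i).
    rewrite -[in RHS](sin_half_reflect R p) -[X in _ = X * _ - _](cos_half_reflect R p).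
    by rewrite coskD sinkD coskN sinkN; ring.
  have -> : sigma = - m * gamma / b by rewrite slope mulrC mulKf.
  by rewrite beE; field.
exists x; rewrite FE /face_at xE; congr (_ `&` _); apply/seteqP.
have gb : gamma / b != 0 by rewrite mulf_neq0 ?invr_neq0 ?lt0r_neq0.
have gbb : gamma / b * b = gamma by rewrite divfK ?lt0r_neq0.
have dotZ v : ((gamma / b *: a) *m v) 0 0 = gamma / b * (a *m v) 0 0.
  by rewrite -scalemxAl mxE.
split=> v /=; rewrite dotZ; first by move=> ->.
by rewrite -[RHS]gbb => /(mulfI gb).
Qed.

End BipyramidFaces.

(** * The matrices of the prismatic group *)

Section PrismaticGroup.
Variables (R : realType) (p : nat).
Local Notation n := p.+3.
Local Notation c := (@cosk R p).
Local Notation s := (@sink R p).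
Implicit Types (k j : 'I_n) (a b e : bool) (x : 'I_n * bool) (g h : prism p).

Definition prism_mx g : 'M[R]_3 :=
  let: (k, a, b) := g in
  mx3 [:: [:: c k; - (-1) ^+ b * s k; 0]; [:: s k; (-1) ^+ b * c k; 0];
          [:: 0; 0; (-1) ^+ a]].

Lemma prism_mx_pt k a b (x y w : R) :
  prism_mx (k, a, b) *m pt x y w =
  pt (c k * x - (-1) ^+ b * s k * y) (s k * x + (-1) ^+ b * c k * y) ((-1) ^+ a * w).
Proof. by rewrite mx3_pt; congr pt; ring. Qed.

(** Matrices act on the left, so the order of the factors is reversed. *)
Lemma prism_mxM g h : prism_mx (g * h)%g = prism_mx h *m prism_mx g.
Proof.
case: g h => [[k a] b] [[k' a'] b']; apply: eq_mx_pt => x y w.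
rewrite -mulmxA prismME !prism_mx_pt coskD sinkD !signr_addb.
by case: b'; rewrite /signed /= ?coskN ?sinkN; congr pt; ring.
Qed.

Lemma prism_mx1 : prism_mx 1%g = 1%:M.
Proof.
apply: eq_mx_pt => x y w; rewrite mul1mx prism1E prism_mx_pt cosk0 sink0.
by congr pt; ring.
Qed.

Lemma tr_prism_mx g : (prism_mx g)^T = prism_mx g^-1%g.
Proof.
case: g => [[k a] b].
rewrite -[(_ ^-1)%g]/((- signed b k, a, b) : prism p); apply/matrixP => i j.
rewrite !mxE /signed coskN.
by case: b; case: i j => [[|[|[|?]]] ?] [[|[|[|?]]] ?] //=; rewrite ?coskN ?sinkN; ring.
Qed.

Lemma prism_mx_orthogonal g : (prism_mx g)^T *m prism_mx g = 1%:M.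
Proof. by rewrite tr_prism_mx -prism_mxM mulgV prism_mx1. Qed.

Lemma invmx_prism g : invmx (prism_mx g) = prism_mx g^-1%g.
Proof.
have gV : prism_mx g^-1%g *m prism_mx g = 1%:M by rewrite -prism_mxM mulgV prism_mx1.
have [_ gu] := mulmx1_unit gV.
by rewrite -[RHS](mulmxK gu) gV mul1mx.
Qed.

Lemma prism_mx_turn1 : prism_mx (1, false, false) = rotation_z (2 * pi / n%:R).
Proof.
apply: eq_mx_pt => x y w; rewrite prism_mx_pt mx3_pt /cosk /sink muln1.
by congr pt; ring.
Qed.

Lemma prism_mx_flip : prism_mx (0, true, false) = reflection_z R.
Proof.
by apply: eq_mx_pt => x y w; rewrite prism_mx_pt mx3_pt cosk0 sink0; congr pt; ring.
Qed.

Lemma prism_mx_mirror : prism_mx (0, false, true) = reflection_y R.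
Proof.
by apply: eq_mx_pt => x y w; rewrite prism_mx_pt mx3_pt cosk0 sink0; congr pt; ring.
Qed.

Lemma prismatic_groupE : prismatic_group R n = range prism_mx.
Proof.
apply/seteqP; split.
  apply: smallest_sub; first split.
  - by move=> _ [g _ <-]; apply: prism_mx_orthogonal.
  - by exists 1%g => //; apply: prism_mx1.
  - by move=> _ _ [g _ <-] [h _ <-]; exists (h * g)%g => //; apply: prism_mxM.
  - by move=> _ [g _ <-]; exists g^-1%g => //; rewrite invmx_prism.
  move=> M [[->|->]|->]; [rewrite -prism_mx_turn1 | rewrite -prism_mx_flip |
    rewrite -prism_mx_mirror]; by eexists.
move=> _ [g _ <-] A [isoA genA]; have [_ A1 AM _] := isoA.
have Aturn (i : nat) : A (prism_mx (((1%R, false, false) : prism p) ^+ i)%g).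
  elim: i => [|i IHi]; first by rewrite expg0 prism_mx1.
  rewrite expgS prism_mxM; apply: AM; first exact: IHi.
  rewrite prism_mx_turn1.
  by apply: genA; left; left.
have Aflip a : A (prism_mx (0, a, false)).
  case: a; last by rewrite -prism1E prism_mx1.
  by rewrite prism_mx_flip; apply: genA; left; right.
have Amirror b : A (prism_mx (0, false, b)).
  case: b; last by rewrite -prism1E prism_mx1.
  by rewrite prism_mx_mirror; apply: genA; right.
case: g => [[k a] b].
have -> : (k, a, b) =
    (((0, false, b) : prism p) * ((0, a, false) : prism p) *
      ((1%R, false, false) : prism p) ^+ (val k))%g.
  rewrite prism_rotationX !prismME /= andbF !addbF /= natr_Zp.
  by rewrite /prism_turn /= !addr0.
by rewrite !prism_mxM; apply: (AM) => //; apply: (AM).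
Qed.

Variable z : R.
Hypothesis z_gt0 : 0 < z.
Local Notation gamma := (cos_half R p).
Local Notation sigma := (sin_half R p).
Local Notation P := (bipyramid n z).

Lemma prism_mx_vertices g v : vertices p z v -> vertices p z (prism_mx g *m v).
Proof.
case: g => [[k a] b] /verticesP[[e ->]|[j ->]]; rewrite prism_mx_pt.
  rewrite !mulr0 subr0 addr0 mulrA -signr_addb; exact: pole_vertex.
have -> : pt (c k * c j - (-1) ^+ b * s k * s j) (s k * c j + (-1) ^+ b * c k * s j)
    ((-1) ^+ a * 0) = pt (c (k + signed b j)) (s (k + signed b j)) 0.
  by rewrite coskD sinkD /signed; case: b; rewrite /= ?coskN ?sinkN; congr pt; ring.
exact: equatorial_vertex.
Qed.

Lemma prism_mx_bipyramid g v : P v -> P (prism_mx g *m v).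
Proof. by apply: mximage_convex_hull; apply: prism_mx_vertices. Qed.

(** The reflection in the plane [y = 0] sends the edge after the vertex [j] to the
    edge after [- j - 1]; this and the next lemma compare the middles of these
    edges. *)
Lemma reflect_normal_x j :
  gamma * c (- j - 1) - sigma * s (- j - 1) = gamma * c j - sigma * s j.
Proof.
transitivity ((gamma * c 1 + sigma * s 1) * c j - (gamma * s 1 - sigma * c 1) * s j).
  by rewrite -opprD coskN sinkN coskD sinkD; ring.
by rewrite cos_half_reflect sin_half_reflect.
Qed.

Lemma reflect_normal_y j :
  gamma * s (- j - 1) + sigma * c (- j - 1) = - (gamma * s j + sigma * c j).
Proof.
transitivity (- ((gamma * c 1 + sigma * s 1) * s j + (gamma * s 1 - sigma * c 1) * c j)).
  by rewrite -opprD coskN sinkN coskD sinkD; ring.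
by rewrite cos_half_reflect sin_half_reflect.
Qed.

Lemma prism_mx_outer_normal g x :
  prism_mx g *m (outer_normal z x)^T = (outer_normal z (face_action p x g))^T.
Proof.
case: g x => [[k a] b] [j e]; rewrite [face_action _ _ _]face_moveE !trmxK prism_mx_pt /=.
rewrite -/gamma -/sigma !mulrA -signr_addb [a (+) e]addbC.
case: b; rewrite /= ?expr0 ?expr1; last by rewrite coskD sinkD; congr pt; ring.
move: (- j - 1) (reflect_normal_x j) (reflect_normal_y j) => l Nx Ny.
by rewrite coskD sinkD -Nx -[gamma * s j + _]opprK -Ny; congr pt; ring.
Qed.

Lemma mximage_face_at g x : mximage (prism_mx g) (face_at z x) = face_at z (face_action p x g).
Proof.
have normalE (v : point3 R) : (outer_normal z (face_action p x g) *m (prism_mx g *m v)) 0 0 =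
    (outer_normal z x *m v) 0 0.
  rewrite -[outer_normal z (face_action p x g)]trmxK -prism_mx_outer_normal.
  rewrite trmx_mul trmxK -mulmxA (mulmxA (prism_mx g)^T).
  by rewrite prism_mx_orthogonal mul1mx.
have mxK (v : point3 R) : prism_mx g *m (prism_mx g^-1%g *m v) = v.
  by rewrite mulmxA -prism_mxM mulVg prism_mx1 mul1mx.
apply/seteqP; split => [_ [v [Pv vx] <-]|v [Pv vx]].
  by split; [apply: prism_mx_bipyramid | rewrite /= normalE].
exists (prism_mx g^-1%g *m v); last exact: mxK.
split; first exact: prism_mx_bipyramid.
by rewrite /= -normalE mxK.
Qed.

End PrismaticGroup.

(** * Tilings of the bipyramid *)

Section BipyramidTilings.
Variables (R : realType) (p : nat) (z : R) (T : finType).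
Local Notation n := p.+3.
Local Notation P := (bipyramid n z).
Local Notation A := (prismatic_group R n).
Local Notation X := ('I_n * bool)%type.
Hypothesis z_gt0 : 0 < z.
Variable D : tile_designs P A T.
Implicit Types (x : X) (g h : prism p) (F : faces P) (tau sigma : tiling P T).

Definition face x : faces P := exist _ (face_at z x) (mem_set (face_at_is_face z_gt0 x)).

Lemma face_surj F : exists x, F = face x.
Proof.
have [x Fx] := face_atP z_gt0 (set_mem (valP F)).
by exists x; apply: val_inj.
Qed.

Definition face_index F : X := sval (cid (face_surj F)).

Lemma face_indexK : cancel face_index face.
Proof. by move=> F; rewrite -(svalP (cid (face_surj F))). Qed.

Lemma faceK : cancel face face_index.
Proof.
move=> x; apply: (face_at_inj z_gt0).
by have := congr1 val (face_indexK (face x)).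
Qed.

Fact prism_elt_subproof g : prism_mx R g \in A.
Proof. by apply/mem_set; rewrite prismatic_groupE; exists g. Qed.

Definition prism_elt g : A := exist _ (prism_mx R g) (prism_elt_subproof g).

Lemma prism_elt_surj (M : A) : exists g, M = prism_elt g.
Proof.
have : range (prism_mx R (p := p)) (val M).
  by move: (set_mem (valP M)); rewrite {1}prismatic_groupE.
by move=> [g _ gM]; exists g; apply: val_inj.
Qed.

(** The action of the symmetries on [T * faces], read on the combinatorial
    faces. *)
Definition design_move (tx : T * X) g : T * X :=
  let q := D (prism_elt g) (tx.1, face tx.2) in (q.1, face_index q.2).

Lemma design_moveE t x g :
  D (prism_elt g) (t, face x) = ((design_move (t, x) g).1, face (face_action p x g)).
Proof.
rewrite [LHS]surjective_pairing; congr (_, _); apply: val_inj.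
by rewrite td_over /= mximage_face_at.
Qed.

Lemma design_move_over t x g : (design_move (t, x) g).2 = face_action p x g.
Proof. by rewrite /design_move /= design_moveE /= faceK. Qed.

Fact design_move_is_action : is_action [set: prism p]%SET design_move.
Proof.
apply: is_total_action => [[t x] | [t x] g h].
  rewrite /design_move td_act1 /=; last exact: prism_mx1.
  by rewrite faceK.
have DM := @td_actM _ _ _ _ D (prism_elt h) (prism_elt g) (prism_elt (g * h)%g) (prism_mxM R g h).
by rewrite /design_move DM /= !design_moveE /= !faceK design_moveE.
Qed.

Canonical design_action := Action design_move_is_action.

Let move := transport_action design_move_over.

Definition encode tau : {ffun X -> T} := [ffun x => tau (face x)].

Lemma encodeE tau x : encode tau x = tau (face x). Proof. by rewrite ffunE. Qed.

Definition decode (sigma : {ffun X -> T}) : tiling P T := fun F => sigma (face_index F).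

Lemma decodeK : cancel decode encode.
Proof. by move=> sigma; apply/ffunP => x; rewrite ffunE /decode faceK. Qed.

Lemma moves_toP g tau sigma :
  moves_to D (prism_elt g) tau sigma <-> encode sigma = move (encode tau) g.
Proof.
have DE x : D (prism_elt g) (tau (face x), face x) =
    (move (encode tau) g (face_action p x g), face (face_action p x g)).
  rewrite design_moveE; congr (_, _).
  by rewrite -encodeE; apply: (congr1 fst (transportE design_move_over (encode tau) g x)).
split=> [tau_sigma | sigmaE].
  apply/ffunP => y; have [x ->] : exists x, y = face_action p x g.
    by exists (face_action p y g^-1)%g; rewrite actKV.
  have : tiling_graph sigma (D (prism_elt g) (tau (face x), face x)).
    by rewrite tau_sigma; exists (tau (face x), face x) => //; exists (face x).
  by rewrite DE encodeE => -[F _ [<- FE]]; rewrite FE.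
rewrite /moves_to /tiling_graph; apply/seteqP; split=> [_ [F _ <-] | _ [_ [F _ <-] <-]].
  have [y ->] := face_surj F; exists (tau (face (face_action p y g^-1)%g), face (face_action p y g^-1)%g).
    by exists (face (face_action p y g^-1)%g).
  by rewrite DE actKV -sigmaE encodeE.
have [x ->] := face_surj F; exists (face (face_action p x g)) => //.
by rewrite DE -sigmaE encodeE.
Qed.

Lemma tiling_orbitE tau :
  tiling_orbit D tau = [set sigma | encode sigma \in orbit move [set: prism p]%SET (encode tau)].
Proof.
apply/seteqP; split=> sigma /= => [[M] | /orbitP[g _ gE]].
  have [g ->] := prism_elt_surj M; move=> /moves_toP ->; apply: mem_orbit; exact: finset.in_setT.
by exists (prism_elt g); apply/moves_toP.
Qed.

(** Sets of tilings are compared with finite sets of encoded tilings through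
    preimage by [encode], which is injective as [encode] is onto. *)
Lemma card_tiling_orbitsE :
  (tiling_orbits D #= `I_#|orbit move [set: prism p]%SET @: [set: {ffun X -> T}]%SET|)%card.
Proof.
set O := (_ @: _)%SET.
pose lift (o : {set {ffun X -> T}}) : set (tiling P T) := [set sigma | encode sigma \in o].
have lift_inj : injective lift.
  move=> o o' oo'; apply/setP => s.
  have : lift o (decode s) = lift o' (decode s) by rewrite oo'.
  by rewrite /lift /= decodeK => e; apply/idP/idP; rewrite e.
have -> : tiling_orbits D = (fun i : 'I_#|O| => lift (enum_val i)) @` [set: 'I_#|O|].
  apply/seteqP; split=> [_ [tau _ <-] | _ [i _ <-]].
    have oO : orbit move [set: prism p]%SET (encode tau) \in O by apply: imset_f; rewrite inE.
    by exists (enum_rank_in oO (orbit move [set: prism p]%SET (encode tau))) => //;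
      rewrite enum_rankK_in // tiling_orbitE.
  have /imsetP[s _ ->] := enum_valP i.
  by exists (decode s) => //; rewrite tiling_orbitE decodeK.
apply: card_eq_trans (card_esym card_II).
by apply: inj_card_eq => i j _ _ /lift_inj/enum_val_inj.
Qed.

End BipyramidTilings.

(** The equatorial vertices exchanged by the reflection are different points. *)
Lemma induces_reflection_neq1 (R : realType) (p : nat) (z : R) (g : prism p)
    (F : set (point3 R)) :
  induces_reflection p.+3 z (prism_mx R g) F -> g != 1%g.
Proof.
move=> [_ [e [i [j [[i_lt j_lt ij] [_ [_ gij _]]]]]]]; apply/eqP => g1.
move: gij; rewrite g1 prism_mx1 mul1mx.
rewrite (equatorialE R (Ordinal i_lt)) (equatorialE R (Ordinal j_lt)) => /pt_inj[cij sij _].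
by have := cosk_sink_inj cij sij => /(congr1 val)/= ijE; rewrite ijE eqxx in ij.
Qed.

Lemma fixed_designsE (R : realType) (p : nat) (z : R) (T : finType) (z_gt0 : 0 < z)
    (D : tile_designs (bipyramid p.+3 z) (prismatic_group R p.+3) T) x g :
  face_action p x g = x ->
  fixed_designs D (face z_gt0 x) (prism_elt R g) =
    #|bto_fixed (design_action z_gt0 D) x g|.
Proof.
move=> gx; apply: eq_card => t; rewrite !inE; apply/asboolP/eqP => e.
  by rewrite [LHS]/(design_move _ _ _ _) /design_move e /= faceK.
by rewrite design_moveE gx; congr (_, _); apply: (congr1 fst e).
Qed.

Theorem theorem18 (R : realType) (n : nat) (z : R) (T : finType)
    (D : tile_designs (bipyramid n z) (prismatic_group R n) T)
    (F : faces (bipyramid n z)) (f : prismatic_group R n)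
    (tid tf : nat) :
  (3 <= n)%N -> 0 < z ->
  #|T| = tid ->
  induces_reflection n z (\val f) (\val F) ->
  fixed_designs D F f = tf ->
  exists N : nat,
    (tiling_orbits D #= `I_N)%card /\
    (~~ odd n ->
      (N%:R : rat) =
        (4 * n)%:R^-1 *
        (n%:R * tid%:R ^+ n
         + n%:R * (2^-1 * tid%:R ^+ n + 2^-1 * tid%:R ^+ (n - 2) * tf%:R ^+ 4)
         + \sum_(d <- divisors n)
             ((totient d)%:R * tid%:R ^+ (2 * n %/ d)
              + (totient d)%:R * tid%:R ^+ (2 * n %/ lcmn d 2)))) /\
    (odd n ->
      (N%:R : rat) =
        (4 * n)%:R^-1 *
        (n%:R * tid%:R ^+ n
         + n%:R * tid%:R ^+ (n - 1) * tf%:R ^+ 2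
         + \sum_(d <- divisors n)
             ((totient d)%:R * tid%:R ^+ (2 * n %/ d)
              + (totient d)%:R * tid%:R ^+ (2 * n %/ lcmn d 2)))).
Proof.
move=> n_ge3 z_gt0; case: n n_ge3 D F f => [|[|[|p]]] // _ D F f tidE fF tfE.
have [g fg] := prism_elt_surj f; have [x Fx] := face_surj z_gt0 F.
have g_neq1 : g != 1%g by move: fF; rewrite fg => /induces_reflection_neq1.
have gx : face_action p x g = x.
  apply: (face_at_inj z_gt0); rewrite -mximage_face_at //.
  by have [+ _] := fF; rewrite fg Fx.
have count := card_tiling_orbits (design_move_over z_gt0 D) g_neq1 gx.
rewrite -fixed_designsE // -fg -Fx tfE tidE in count.
eexists; split; first exact: card_tiling_orbitsE z_gt0 D.
set N := #|_| in count *; set n := p.+3 in count *.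
have solve (S : rat) (s : nat) : (N * (4 * n))%N = s -> s%:R = S -> N%:R = (4 * n)%:R^-1 * S.
  move=> Ns <-; apply: (mulfI (_ : (4 * n)%:R != 0)); first by rewrite pnatr_eq0.
  by rewrite mulVKf ?pnatr_eq0 // -natrM -Ns mulnC.
have sumE : (\sum_(d <- divisors n)
       (totient d * tid ^ (2 * n %/ d) + totient d * tid ^ (2 * n %/ lcmn d 2)))%N%:R =
    \sum_(d <- divisors n) ((totient d)%:R * tid%:R ^+ (2 * n %/ d)
              + (totient d)%:R * tid%:R ^+ (2 * n %/ lcmn d 2)) :> rat.
  by rewrite natr_sum; apply: eq_bigr => d _; rewrite natrD !natrM !natrX.
split=> parity; apply: (solve _ _ count); rewrite 2!natrD sumE; congr (_ + _ + _).
- by rewrite natrM natrX.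
- rewrite (sum_mirror_even (fun m => tf ^ (2 * m) * tid ^ (n - m))%N) //.
  have -> : n%:R = 2 * (n./2)%:R :> rat by rewrite -natrM mul2n even_halfK.
  have castE (q a b c : nat) :
      (q * a + q * (b * c))%N%:R = q%:R * a%:R + q%:R * (b%:R * c%:R) :> rat.
    by rewrite natrD !natrM.
  by rewrite muln0 expn0 mul1n subn0 castE 3!natrX; field.
- by rewrite natrM natrX.
rewrite (eq_bigr (fun=> tf ^ 2 * tid ^ (n - 1))%N) => [|k _]; last first.
  by rewrite card_mirror_faces_odd.
by rewrite sum_nat_const card_ord 2!natrM 2!natrX -mulrA [X in _ * X]mulrC.
Qed.
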